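(* Let $(G,v_G)$ and $(H,v_H)$ be rooted graphs and let $g,h\ge 0$, $m\ge 2$ be integers. Let $K_m^{gh}(G,H)$ be the graph obtained from the disjoint union of $G$, $H$ and a complete graph $K_m$ with two distinct chosen vertices $x,y$ by adding a path of length $g$ joining $v_G$ and $x$ and a path of length $h$ joining $y$ and $v_H$ (a path of length $0$ meaning identification of its ends). Then \[ \frac{X_{K_m^{gh}(G,H)}}{(m-2)!}=\sum_{z=1}^{m-1}z\,e_{m-1-z}\,X_{P^{g+h+z}(G,H)}+(m-2)\sum_{\substack{a+b+c=m-2\\ a,b,c\ge 0}}(a-1)\,e_a\,X_{G^{b+g}}\,X_{H^{c+h}}. \]
   Context: All graphs are finite simple graphs. The chromatic symmetric function of a graph $G$ is $X_G=\sum_{\kappa}\prod_{v\in V(G)}x_{\kappa(v)}$, where $\kappa$ ranges over proper colorings $\kappa:V(G)\to\{1,2,\dots\}$; $e_a$ is the $a$-th elementary symmetric function, $e_0=1$. For rooted graphs $(G,u)$, $(H,v)$ and $k\ge0$, $P^k(G,H)$ is obtained from the disjoint union of $G$ and $H$ by adding a path of length $k$ (with $k-1$ new internal vertices) joining $u$ and $v$ (for $k=0$ identifying them), and $G^k=P^k(G,K_1)$ is $G$ with a pendant path of length $k$ at its root. *)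

(* Defs.v *)
From HB Require Import structures.
From mathcomp Require Import all_boot all_order all_algebra.
From mathcomp Require Import mpoly.
Set Implicit Arguments. Unset Strict Implicit. Unset Printing Implicit Defensive.
Import GRing.Theory.

Record graph := Graph { gV : finType; gadj : rel gV }.
Arguments gadj : clear implicits.

Definition simple (G : graph) : Prop := ssrbool.symmetric (gadj G) /\ irreflexive (gadj G).

Definition Kgraph (m : nat) : graph := @Graph ('I_m) (fun i j => i != j).
Definition K1 : graph := @Graph unit (fun _ _ => false).

(* P^k(G,H) for rooted (G,u), (H,v): vertices of G, k path slots and the
   vertices of H other than v.  Path position 0 is u, position i (1<=i<=k)
   is slot i-1; position k represents v (for k = 0 this identifies u and v). *)
Section PathJoin.
Variables (G : graph) (u : gV G) (H : graph) (v : gV H) (k : nat).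

Definition PV : finType := ((gV G + 'I_k) + {h : gV H | h != v})%type.

Definition posV (i : nat) : PV :=
  match i with
  | 0 => inl (inl u)
  | j.+1 => if @insub _ (fun t => t < k) _ j is Some o then inl (inr o) else inl (inl u)
  end.

Definition embG (a : gV G) : PV := inl (inl a).

Definition embH (b : gV H) : PV :=
  match @insub _ (fun t => t != v) _ b with
  | Some s => inr s
  | None => posV k
  end.

Definition Padj (x y : PV) : bool :=
  [|| [exists a, exists b, [&& gadj G a b, x == embG a & y == embG b]],
      [exists a, exists b, [&& gadj H a b, x == embH a & y == embH b]]
    | [exists i : 'I_k, ((x == posV i) && (y == posV i.+1))
                        || ((x == posV i.+1) && (y == posV i))]].

Definition Pgraph : graph := @Graph PV Padj.
End PathJoin.

Definition Gpend (G : graph) (u : gV G) (k : nat) : graph :=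
  Pgraph u (tt : gV K1) k.

Definition KmGH (G : graph) (vG : gV G) (H : graph) (vH : gV H)
  (g h m : nat) (x y : 'I_m) : graph :=
  let GK := Pgraph vG (x : gV (Kgraph m)) g in
  Pgraph (@embH G vG (Kgraph m) x g y : gV GK) vH h.

(* Chromatic symmetric function specialised to N variables x_0..x_{N-1}. *)
Definition proper (G : graph) (N : nat) (c : {ffun gV G -> 'I_N}) : bool :=
  [forall a, forall b, gadj G a b ==> (c a != c b)].

Definition csf (N : nat) (G : graph) : {mpoly rat[N]} :=
  \sum_(c : {ffun gV G -> 'I_N} | proper c) \prod_(w : gV G) 'X_(c w).

Definition elem (N a : nat) : {mpoly rat[N]} := mesym N rat a.

(* Main.v *)
(** For a rooted graph [(G, u)] let [f_G(i)] be the sum, over proper colourings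
    giving [u] colour [i], of the weights of all vertices other than [u].  With
    [M i j = [i != j] x_j] (multiplying by [M] crosses one edge of a path) one has
      [X_{P^k(G,H)} = sum_(i,j) x_i f_H(i) (M^k)_(i,j) f_G(j)],
    and gluing in a clique replaces [M^k] by [(m-2)! x_j e_{m-2}(x \ {x_i, x_j})]
    off the diagonal.  As [M] is self-adjoint for the form weighted by [x], the
    lengths [g] and [h] are absorbed into [f_G] and [f_H], and the claim becomes
    an identity of matrix entries.  In generating functions, with
    [E(t) = prod_i (1 + x_i t)] and [R = (1 - tM)^-1], it follows from the
    Sherman-Morrison formula for [1 - tM = (1 + tD) - t 1 x^T], where
    [D = diag(x)] and [det (1 - tM) = E - tE'], together with
    [E tR' = t(ER)' - tE'R]. *)
Require Import Defs.
From HB Require Import structures.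
From mathcomp Require Import all_boot all_order all_algebra.
From mathcomp Require Import mpoly.
From mathcomp Require Import ring zify.
Import GRing.Theory.
Local Open Scope ring_scope.
Set Implicit Arguments. Unset Strict Implicit. Unset Printing Implicit Defensive.

(* [fintype.proper], about sets, shadows the colouring predicate. *)
Local Notation proper := Defs.proper.

(** * Powers of the path matrix *)

(** The elementary symmetric polynomial in the variables indexed by [A]; it is needed with one or
    two variables removed. *)
Definition esym_on (R : comNzRingType) (N : nat) (x : 'I_N -> R)
    (A : {set 'I_N}) (n : nat) : R :=
  \sum_(B : {set 'I_N} | (B \subset A) && (#|B| == n)) \prod_(k in B) x k.

Lemma esym_on0 (R : comNzRingType) (N : nat) (x : 'I_N -> R) A :
  esym_on x A 0 = 1.
Proof.
rewrite /esym_on (big_pred1 set0) ?big_set0 // => B.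
by rewrite /= cards_eq0; case: eqP => [->|]; rewrite ?sub0set ?andbF.
Qed.

Lemma esym_onS (R : comNzRingType) (N : nat) (x : 'I_N -> R)
    (k : 'I_N) (A : {set 'I_N}) n :
  k \in A ->
  esym_on x A n.+1 = esym_on x (A :\ k) n.+1 + x k * esym_on x (A :\ k) n.
Proof.
move=> kA; rewrite /esym_on (bigID (fun B : {set 'I_N} => k \notin B)) /=.
congr (_ + _).
  by apply: eq_bigl => B; rewrite subsetD1 andbAC.
rewrite (reindex_onto (fun B => k |: B) (fun B => B :\ k)) /=; last first.
  by move=> B /andP[_]; rewrite negbK => kB; rewrite setD1K.
rewrite mulr_sumr; apply: eq_big => [B|B /andP[_ /eqP BE]].
  rewrite setU11 andbT subUset sub1set kA /= subsetD1.
  case kB: (k \in B).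
    rewrite andbF /=; apply/negbTE; rewrite negb_and; apply/orP; right.
    by apply: contraTneq kB => <-; rewrite setD11.
  by rewrite setU1K ?kB // eqxx !andbT cardsU1 kB add1n eqSS.
by rewrite big_setU1 //= -BE setD11.
Qed.

(** Double counting of the pairs [k \in B] with [B] of size [n.+1]; the right side is a coefficient
    of [tE']. *)
Lemma sum_esym_onD1 (R : comNzRingType) (N : nat) (x : 'I_N -> R)
    (A : {set 'I_N}) n :
  \sum_(k in A) x k * esym_on x (A :\ k) n = n.+1%:R * esym_on x A n.+1.
Proof.
rewrite mulr_natl -sumrMnl.
transitivity (\sum_(B : {set 'I_N} | (B \subset A) && (#|B| == n.+1))
   \sum_(k in B) \prod_(l in B) x l); last first.
  by apply: eq_bigr => B /andP[_ /eqP cB]; rewrite sumr_const cB.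
rewrite (exchange_big_dep (mem A)) /=; last first.
  by move=> B k /andP[/subsetP sBA _] /sBA.
apply: eq_bigr => k kA; rewrite mulr_sumr.
rewrite [RHS](reindex_onto (fun B => k |: B) (fun B => B :\ k)) /=; last first.
  by move=> B /andP[_] kB; rewrite setD1K.
apply: eq_big => [B|B].
  rewrite setU11 andbT subUset sub1set kA /= subsetD1.
  case kB: (k \in B).
    rewrite andbF /=; apply/esym/negbTE; rewrite negb_and; apply/orP; right.
    by apply: contraTneq kB => <-; rewrite setD11.
  by rewrite setU1K ?kB // eqxx !andbT cardsU1 kB add1n eqSS.
by rewrite subsetD1 => /andP[/andP[_ kB] _]; rewrite big_setU1.
Qed.

Section PathMatrix.
Variables (R : comNzRingType) (N : nat) (x : 'I_N -> R).

Definition path_mx : 'M[R]_N := \matrix_(i, j) ((i != j)%:R * x j).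

Definition walk_col (c : nat) : 'cV[R]_N := path_mx ^+ c *m const_mx 1.

Local Notation M := path_mx.
Local Notation e := (esym_on x setT).
Local Notation s i := (esym_on x (setT :\ i)).
Local Notation d i j := (esym_on x (setT :\ i :\ j)).
Local Notation W c i := (walk_col c i 0).
(** Coefficient of [t^n] in [E - tE'], the determinant of [1 - tM]. *)
Local Notation p n := ((1 - n%:R) * e n).

(** [M] is the rank-one matrix [1 x^T] minus [diag(x)]; hence the full sum and the correction at
    [i]. *)
Lemma mul_path_mx q (A : 'M[R]_(N, q)) i j :
  (M *m A) i j = \sum_k x k * A k j - x i * A i j.
Proof.
rewrite mxE (bigD1 i) //= !mxE eqxx mul0r mul0r add0r.
rewrite [in RHS](bigD1 i) //= addrC addrK.
by apply: eq_bigr => k; rewrite mxE eq_sym => ->; rewrite mul1r.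
Qed.

Lemma mulmx_path q (A : 'M[R]_(q, N)) i j :
  (A *m M) i j = x j * (\sum_k A i k - A i j).
Proof.
rewrite mxE (bigD1 j) //= !mxE eqxx mul0r mulr0 add0r.
rewrite [in RHS](bigD1 j) //= [A i j + _]addrC addrK mulr_sumr.
by apply: eq_bigr => k; rewrite mxE => ->; rewrite mul1r mulrC.
Qed.

Lemma walk_colS c i : W c.+1 i = \sum_k x k * W c k - x i * W c i.
Proof. by rewrite /walk_col exprS -mulmxE -mulmxA mul_path_mx. Qed.

Lemma walk_col0 i : W 0 i = 1.
Proof. by rewrite /walk_col expr0 mul1mx mxE. Qed.

(* Coefficients of [(E - tE') R 1 = E / (1 + x_i t)]. *)
Lemma esym_walk n i :
  \sum_(c < n.+1) p (n - c)%N * W c i = s i n.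
Proof.
elim: n i => [|n IHn] i.
  by rewrite big_ord1 !esym_on0 walk_col0 subr0 !mulr1.
rewrite big_ord_recl subn0 walk_col0 mulr1.
under eq_bigr => c _ do
  rewrite lift0 subSS walk_colS mulrBr mulr_sumr.
rewrite sumrB exchange_big /=.
have -> : \sum_(c < n.+1) p (n - c)%N * (x i * W c i) = x i * s i n.
  by rewrite -IHn mulr_sumr; apply: eq_bigr => c _; rewrite mulrCA.
have -> : \sum_j \sum_(c < n.+1) p (n - c)%N * (x j * W c j) = n.+1%:R * e n.+1.
  rewrite -sum_esym_onD1; apply: eq_big => [j|j _]; first by rewrite in_setT.
  by rewrite -IHn mulr_sumr; apply: eq_bigr => c _; rewrite mulrCA.
(* [p n.+1 + n.+1%:R * e n.+1] is [e n.+1], and removing [x i * s i n] leaves [s i n.+1]. *)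
rewrite (@esym_onS _ _ _ i setT n) ?in_setT //.
ring.
Qed.

(* Coefficients of [E R = E B + t (R 1) (x^T E B)], where [B = (1 + tD)^-1]. *)
Lemma esym_path_mx n i j :
  \sum_(z < n.+2) e (n.+1 - z)%N * (M ^+ z) i j =
  (i == j)%:R * s i n.+1 + x j * \sum_(c < n.+1) W c i * s j (n - c)%N.
Proof.
elim: n i j => [|n IHn] i j.
  rewrite !big_ord_recl !big_ord0 /= expr0 expr1 !esym_on0 walk_col0 !mxE.
  rewrite (@esym_onS _ _ _ i setT) ?in_setT // !esym_on0.
  by case: eqVneq => [->|_] /=; ring.
rewrite big_ord_recl expr0 subn0 [1%:M i j]mxE.
under eq_bigr => z _ do
  rewrite lift0 subSS exprS -mulmxE mul_path_mx mulrBr mulr_sumr.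
rewrite sumrB exchange_big /=.
have E l : \sum_(z < n.+2) e (n.+1 - z)%N * (x l * (M ^+ z) l j) =
    (l == j)%:R * x l * s l n.+1
    + x j * \sum_(c < n.+1) x l * W c l * s j (n - c)%N.
  transitivity (x l * \sum_(z < n.+2) e (n.+1 - z)%N * (M ^+ z) l j).
    by rewrite mulr_sumr; apply: eq_bigr => c _; rewrite mulrCA.
  rewrite IHn mulrDr mulrA [x l * _%:R]mulrC mulrCA; congr (_ + _ * _).
  by rewrite mulr_sumr; apply: eq_bigr => c _; rewrite mulrA.
under eq_bigr do rewrite E.
rewrite E big_split /= (bigD1 j) //= eqxx mul1r big1 ?addr0; last first.
  by move=> k /negbTE->; rewrite !mul0r.
rewrite -mulr_sumr exchange_big /=.
(* Unrolling the walks on the right makes the sums over all colours match; only the diagonal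
   remains, where [e n.+2] splits at [i]. *)
rewrite [in RHS]big_ord_recl walk_col0 subn0 mul1r.
under [in RHS]eq_bigr => c _ do
  rewrite lift0 subSS walk_colS mulrBl mulr_suml.
rewrite sumrB mulrDr mulrBr.
rewrite (@esym_onS _ _ _ i setT) ?in_setT //.
by case: eqVneq => [->|_] /=; ring.
Qed.

(* Coefficients of [(E - tE') R = (E - tE') B + t E B 1 x^T B]. *)
Lemma esym_walk_path n i j :
  \sum_(z < n.+2) p (n.+1 - z)%N * (M ^+ z) i j =
  if i == j then - (n%:R * s i n.+1) else x j * d i j n.
Proof.
(* [M ^+ z] applied to the all-ones column is [walk_col z], so row sums fall under [esym_walk]. *)
have rowsum m l : \sum_k \sum_(z < m.+1) p (m - z)%N * (M ^+ z) l k = s l m.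
  rewrite -esym_walk exchange_big; apply: eq_bigr => z _ /=.
  rewrite -mulr_sumr; congr (_ * _); rewrite mxE.
  by apply: eq_bigr => k _; rewrite mxE mulr1.
(* One factor [M] is split off on the right, where its rank-one part only sees row sums. *)
have rec m : \sum_(z < m.+2) p (m.+1 - z)%N * (M ^+ z) i j =
    p m.+1 * (i == j)%:R
    + x j * (s i m - \sum_(z < m.+1) p (m - z)%N * (M ^+ z) i j).
  rewrite big_ord_recl subn0 expr0 [1%:M i j]mxE; congr (_ + _).
  under eq_bigr => z _ do rewrite lift0 subSS exprSr -mulmxE mulmx_path.
  rewrite -rowsum exchange_big /= -sumrB mulr_sumr.
  by apply: eq_bigr => z _; rewrite -mulr_sumr; ring.
elim: n => [|n IHn].
  rewrite rec big_ord1 subnn expr0 mxE !esym_on0; case: eqP => _ /=; ring.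
rewrite rec IHn; case: eqVneq => [<-|nij].
  rewrite (@esym_onS _ _ _ i setT) ?in_setT //=; ring.
rewrite (@esym_onS _ _ _ j (setT :\ i)) ?inE 1?eq_sym ?nij //=; ring.
Qed.

(* By [esym_walk] both sides convolve the walk sequences of [i] and [j] with
   the coefficients of [E - tE']. *)
Lemma walk_esymC n i j :
  \sum_(c < n.+1) W c i * s j (n - c)%N = \sum_(c < n.+1) W c j * s i (n - c)%N.
Proof.
(* Truncation at [n] is harmless: only coefficients up to [n] are read. *)
pose P := \poly_(a < n.+1) p a; pose Q l := \poly_(c < n.+1) W c l.
have coefPQ l m : (m <= n)%N -> (Q l * P)`_m = s l m.
  move=> le_mn; rewrite coefM -esym_walk; apply: eq_bigr => c _.
  rewrite !coef_poly mulrC ltnS.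
  by rewrite !ltnS (leq_trans (leq_subr _ _)) // (leq_trans (leq_ord c)).
have conv k l : \sum_(c < n.+1) W c k * s l (n - c)%N = (Q k * (Q l * P))`_n.
  rewrite coefM; apply: eq_bigr => c _.
  by rewrite coefPQ ?leq_subr // coef_poly ltn_ord.
by rewrite !conv mulrCA.
Qed.

(** The weight [z] combines [esym_path_mx] and [esym_walk_path]: their diagonal terms cancel, and
    [walk_esymC] removes the walk sums. *)
Lemma esym_pair_path n i j :
  (i != j)%:R * x j * d i j n =
  \sum_(1 <= z < n.+2) z%:R * e (n.+1 - z)%N * (M ^+ z) i j
  - n%:R * x j * \sum_(c < n.+1) W c j * s i (n - c)%N.
Proof.
(* [z = n + (1 - (n + 1 - z))] *)
have -> : \sum_(1 <= z < n.+2) z%:R * e (n.+1 - z)%N * (M ^+ z) i j =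
    n%:R * (\sum_(z < n.+2) e (n.+1 - z)%N * (M ^+ z) i j)
    + \sum_(z < n.+2) p (n.+1 - z)%N * (M ^+ z) i j.
  rewrite mulr_sumr -big_split /= -(big_mkord xpredT (fun z =>
    n%:R * (e (n.+1 - z)%N * (M ^+ z) i j) + p (n.+1 - z)%N * (M ^+ z) i j)).
  rewrite [RHS]big_ltn // subn0.
  (* At [z = 0] the coefficient is [n + (1 - (n + 1)) = 0], so the sum may start at 1. *)
  rewrite [X in _ = X + _](_ : _ = 0) ?add0r; last by ring.
  apply: eq_big_nat => z /andP[_ ltz].
  by rewrite natrB //; ring.
rewrite esym_path_mx esym_walk_path walk_esymC.
by case: eqVneq => [->|_] /=; ring.
Qed.

End PathMatrix.

(** * The clique identity in terms of bilinear forms *)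

Lemma sum_ord3 (V : nmodType) (n : nat) (F : nat -> nat -> nat -> V) :
  \sum_(a < n.+1) \sum_(b < n.+1) \sum_(c < n.+1 | (a + b + c == n)%N) F a b c =
  \sum_(b < n.+1) \sum_(c < (n - b).+1) F (n - b - c)%N b c.
Proof.
rewrite exchange_big; apply: eq_bigr => b _ /=.
rewrite (exchange_big_dep xpredT) //=.
rewrite (big_ord_widen n.+1 (fun c => F (n - b - c)%N b c)); last first.
  by rewrite ltnS leq_subr.
rewrite [RHS]big_mkcond; apply: eq_bigr => c _; rewrite ltnS /=.
case: leqP => bc; last first.
  by apply: big_pred0 => a; lia.
have lta : (n - b - c < n.+1)%N by lia.
by rewrite (big_pred1 (Ordinal lta)) // => a;
  have := ltn_ord b; rewrite /= -val_eqE /=; lia.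
Qed.

(** [diag(x) M] is symmetric: both sides weigh all vertices of the walks between [i] and [j], and
    reversal preserves this weight. *)
Lemma path_mxX_sym (R : comNzRingType) (N : nat) (x : 'I_N -> R) z i j :
  x i * (path_mx x ^+ z) i j = x j * (path_mx x ^+ z) j i.
Proof.
elim: z i j => [|z IHz] i j.
  by rewrite expr0 !mxE eq_sym; case: eqP => [->|]; rewrite ?mulr0.
rewrite {1}exprS exprSr -!mulmxE !mxE !mulr_sumr; apply: eq_bigr => k _.
rewrite !mxE [k == i]eq_sym [RHS]mulrA -IHz; ring.
Qed.

(** [esym_pair_path] is paired with [phi] at one end of the clique and [psi] at the other;
    [esym_walk] then separates its last term into products. *)
Lemma esym_pair_form (R : comNzRingType) (N : nat) (x : 'I_N -> R)
    (phi psi : 'I_N -> R) (n : nat) :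
  \sum_j \sum_i x j * psi j *
    ((j != i)%:R * x i * esym_on x (setT :\ j :\ i) n * phi i) =
  \sum_(1 <= z < n.+2) z%:R * (esym_on x setT (n.+1 - z)
     * \sum_j \sum_i x j * psi j * ((path_mx x ^+ z) j i * phi i))
  + n%:R * \sum_(a < n.+1) \sum_(b < n.+1) \sum_(c < n.+1 | (a + b + c == n)%N)
     (a%:R - 1) * (esym_on x setT a * (\sum_i x i * walk_col x b i 0 * phi i)
       * (\sum_j x j * walk_col x c j 0 * psi j)).
Proof.
rewrite (sum_ord3 n (fun a b c => (a%:R - 1) *
  (esym_on x setT a * (\sum_i x i * walk_col x b i 0 * phi i)
   * (\sum_j x j * walk_col x c j 0 * psi j)))).
under eq_bigr => j _ do under eq_bigr => i _ do
  rewrite esym_pair_path mulrBl mulrBr.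
under eq_bigr do rewrite sumrB.
rewrite sumrB; congr (_ + _).
  under [RHS]eq_bigr => z _ do rewrite mulrA mulr_sumr.
  rewrite [RHS]exchange_big; apply: eq_bigr => j _ /=.
  under [RHS]eq_bigr => z _ do rewrite mulr_sumr.
  rewrite [RHS]exchange_big; apply: eq_bigr => i _ /=.
  rewrite mulr_suml mulr_sumr; apply: eq_bigr => z _; ring.
rewrite -sumrN mulr_sumr.
transitivity (\sum_j \sum_i \sum_(b < n.+1) - (n%:R * x j * psi j * x i * phi i
    * (walk_col x b i 0 * esym_on x (setT :\ j) (n - b)))).
  apply: eq_bigr => j _; rewrite -sumrN; apply: eq_bigr => i _.
  by rewrite sumrN -mulr_sumr; ring.
under eq_bigr do rewrite exchange_big.
rewrite exchange_big; apply: eq_bigr => b _ /=.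
transitivity (\sum_j (- (n%:R * x j * psi j * esym_on x (setT :\ j) (n - b)))
    * \sum_i x i * walk_col x b i 0 * phi i).
  by apply: eq_bigr => j _; rewrite mulr_sumr; apply: eq_bigr => i _; ring.
set S := \sum_i x i * walk_col x b i 0 * phi i; move: S => S.
rewrite mulr_sumr.
(* The remaining symmetric function expands into walks from [j]; the sign turns [1 - a] into
   [a - 1], where [a = n - b - c]. *)
under [LHS]eq_bigr => j _ do rewrite -esym_walk mulr_sumr -sumrN mulr_suml.
rewrite exchange_big; apply: eq_bigr => c _ /=.
rewrite ![in RHS]mulrA [RHS]mulr_sumr; apply: eq_bigr => j _; ring.
Qed.

(** The function [f] of a rooted graph after a path of length [k] is hung at its root and the root
    moved to the free end. *)
Definition path_act (R : comNzRingType) (N : nat) (x : 'I_N -> R) (k : nat)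
    (f : 'I_N -> R) (i : 'I_N) : R :=
  \sum_l (path_mx x ^+ k) i l * f l.

(** The [x]-weighted pairing of [f1] with [M^k f2]; [csf_join] identifies it with the chromatic
    symmetric function of a path join. *)
Definition path_form (R : comNzRingType) (N : nat) (x : 'I_N -> R) (k : nat)
    (f1 f2 : 'I_N -> R) : R :=
  \sum_j \sum_i x j * f1 j * ((path_mx x ^+ k) j i * f2 i).

Lemma path_formC (R : comNzRingType) (N : nat) (x : 'I_N -> R) k f1 f2 :
  path_form x k f1 f2 = path_form x k f2 f1.
Proof.
rewrite /path_form exchange_big; apply: eq_bigr => j _.
apply: eq_bigr => i _ /=.
transitivity (x i * (path_mx x ^+ k) i j * f1 i * f2 j); first by ring.
by rewrite path_mxX_sym; ring.
Qed.

Lemma path_form_actr (R : comNzRingType) (N : nat) (x : 'I_N -> R) k l f1 f2 :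
  path_form x k f1 (path_act x l f2) = path_form x (k + l) f1 f2.
Proof.
apply: eq_bigr => j _; rewrite -!mulr_sumr; congr (_ * _).
under eq_bigr do rewrite mulr_sumr.
rewrite exchange_big; apply: eq_bigr => i _ /=.
rewrite exprD -mulmxE mxE mulr_suml; apply: eq_bigr => r _.
by rewrite mulrA.
Qed.

Lemma path_form_actl (R : comNzRingType) (N : nat) (x : 'I_N -> R) k l f1 f2 :
  path_form x k (path_act x l f1) f2 = path_form x (k + l) f1 f2.
Proof. by rewrite path_formC path_form_actr path_formC. Qed.

Lemma path_form0 (R : comNzRingType) (N : nat) (x : 'I_N -> R) f1 f2 :
  path_form x 0 f1 f2 = \sum_j x j * f1 j * f2 j.
Proof.
apply: eq_bigr => j _; rewrite -mulr_sumr (bigD1 j) //= expr0 mxE eqxx mul1r.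
rewrite big1 ?addr0 // => i; rewrite mxE eq_sym => /negbTE->.
by rewrite mul0r.
Qed.

(** The constant 1 is the rooted sum of [K1], so this covers pendant paths. *)
Lemma path_form1 (R : comNzRingType) (N : nat) (x : 'I_N -> R) k f :
  path_form x k (fun _ => 1) f = \sum_i x i * walk_col x k i 0 * f i.
Proof.
rewrite path_formC; apply: eq_bigr => j _; rewrite -mulr_sumr mxE.
under [X in _ = _ * X * _]eq_bigr do rewrite mxE.
by ring.
Qed.

(** * Colourings of joined graphs *)


Lemma big_sig_val (R : Type) (idx : R) (op : Monoid.com_law idx)
    (I : finType) (P : pred I) (F : I -> R) :
  \big[op/idx]_(i | P i) F i = \big[op/idx]_(t : {i | P i}) F (val t).
Proof.
rewrite (reindex_omap (J := {i | P i}) val insub) => [|i Pi];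
  last by rewrite insubT.
by apply: eq_bigl => t; rewrite (valP t) valK eqxx.
Qed.

Lemma big_ffun_recl (R : Type) (idx : R) (op : Monoid.com_law idx)
    (T : finType) (n : nat) (F : {ffun 'I_n.+1 -> T} -> R) :
  \big[op/idx]_q F q =
  \big[op/idx]_(t : T) \big[op/idx]_(q : {ffun 'I_n -> T})
     F [ffun i => oapp q t (unlift ord0 i)].
Proof.
rewrite pair_bigA.
apply: (reindex (fun p : T * {ffun 'I_n -> T} =>
  [ffun i => oapp p.2 p.1 (unlift ord0 i)])).
exists (fun q : {ffun 'I_n.+1 -> T} => (q ord0, [ffun i => q (lift ord0 i)])).
  move=> [t q] _ /=; congr pair; first by rewrite ffunE unlift_none.
  by apply/ffunP=> i; rewrite !ffunE liftK.
move=> q _ /=; apply/ffunP=> i; rewrite ffunE.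
by case: unliftP => [j ->|->] //=; rewrite ffunE.
Qed.

Definition walk (N k : nat) (q : {ffun 'I_k.+1 -> 'I_N}) : bool :=
  [forall s : 'I_k, q (widen_ord (leqnSn k) s) != q (lift ord0 s)].

(** The end [j] carries no weight and [path_mx] weighs its column index, so walks are read
    backwards, from [j] to [i]. *)
Lemma sum_walk (R : comNzRingType) (N : nat) (x : 'I_N -> R) (k : nat)
    (i j : 'I_N) :
  \sum_(q : {ffun 'I_k.+1 -> 'I_N} | [&& walk q, q ord0 == i & q ord_max == j])
     \prod_(s < k) x (q (widen_ord (leqnSn k) s)) = (path_mx x ^+ k) j i.
Proof.
elim: k i => [|k IHk] i.
  under eq_bigr do rewrite big_ord0.
  have walk0 q : [&& @walk N 0 q, q ord0 == i & q ord_max == j] =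
      (i == j) && (q == [ffun => i]).
    have -> : walk q by apply/forallP => -[].
    have -> : ord_max = ord0 :> 'I_1 by apply: val_inj.
    have -> : (q == [ffun => i]) = (q ord0 == i).
      apply/eqP/eqP => [->|qi]; first by rewrite ffunE.
      by apply/ffunP => s; rewrite ord1 ffunE.
    by case: eqP => [->|_]; rewrite ?andbF ?andbT.
  rewrite (eq_bigl _ _ walk0) expr0 mxE eq_sym.
  case: eqP => _ /=; last by rewrite big_pred0_eq.
  by rewrite big_pred1_eq.
(* The first colour is forced to be [i]; the last factor of the power is the first edge of the
   walk. *)
rewrite exprSr -mulmxE mxE big_mkcond big_ffun_recl (bigD1 i) //=.
rewrite [X in _ + X]big1 ?addr0 => [|t ti]; last first.
  by apply: big1 => q _; rewrite ffunE unlift_none /= (negbTE ti) andbF.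
rewrite [LHS](partition_big
  (fun q : {ffun 'I_k.+1 -> 'I_N} => q ord0) xpredT) //=.
apply: eq_bigr => l _; rewrite -IHk mxE mulr_suml [RHS]big_mkcond.
rewrite [LHS]big_mkcond; apply: eq_bigr => q _ /=.
set c := finfun _.
have c0 : c ord0 = i by rewrite ffunE unlift_none.
have cS s : c (lift ord0 s) = q s by rewrite ffunE liftK.
have widenS (s : 'I_k) : widen_ord (leqnSn k.+1) (lift ord0 s) =
    lift ord0 (widen_ord (leqnSn k) s) by apply: val_inj.
have widen0 : widen_ord (leqnSn k.+1) ord0 = ord0 by apply: val_inj.
have maxS : ord_max = lift ord0 ord_max :> 'I_k.+2 by apply: val_inj.
have walkS : walk c = (i != q ord0) && walk q.
  apply/forallP/andP => [wc | [iq /forallP wq] s].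
    split; first by rewrite -{1}c0 -cS -widen0.
    by apply/forallP => s; rewrite -!cS -widenS.
  case: (unliftP ord0 s) => [s'|] ->; first by rewrite widenS !cS.
  by rewrite widen0 c0 cS.
rewrite walkS c0 maxS cS eqxx big_ord_recl widen0 c0 /=.
under eq_bigr => s _ do rewrite widenS cS.
case: (eqVneq (q ord0) l) => [->|]; last by rewrite andbF.
rewrite eq_sym /=; case: eqP => _ /=; last by rewrite mul1r mulrC.
by rewrite mul0r mulr0 if_same.
Qed.

Definition rooted_sum (R : comNzRingType) (N : nat) (x : 'I_N -> R)
    (G : graph) (u : gV G) (i : 'I_N) : R :=
  \sum_(c : {ffun gV G -> 'I_N} | proper c && (c u == i))
     \prod_(w | w != u) x (c w).

Section PathJoinColoring.
Variables (G : graph) (u : gV G) (H : graph) (v : gV H) (k : nat).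
Local Notation P := (Pgraph u v k).
Local Notation eG := (@embG G H v k).
Local Notation eH := (embH u v k).
Local Notation pos := (@posV G u H v k).

Lemma posV_slot (s : 'I_k) : pos s.+1 = inl (inr s).
Proof. by rewrite /= valK. Qed.

Lemma embH_root : eH v = pos k.
Proof. by rewrite /embH insubF ?eqxx. Qed.

Lemma embH_val (t : {w : gV H | w != v}) : eH (val t) = inr t.
Proof. by rewrite /embH valK. Qed.

(** Position 0 stands for [u], and position [k] is counted with [H] as [v]; the path keeps the [k]
    positions weighed in [sum_walk]. *)
Lemma big_PV (R : Type) (idx : R) (op : Monoid.com_law idx)
    (F : PV G v k -> R) :
  \big[op/idx]_w F w =
  op (op (\big[op/idx]_(a | a != u) F (eG a))
         (\big[op/idx]_(s < k) F (pos s)))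
     (\big[op/idx]_b F (eH b)).
Proof.
rewrite big_sumType big_sumType /=.
rewrite (bigD1 u) //= [in RHS](bigD1 v) //=.
have -> : \big[op/idx]_(b | b != v) F (eH b) = \big[op/idx]_t F (inr t).
  rewrite big_sig_val; apply: eq_bigr => t _; congr F; exact: embH_val.
rewrite embH_root !Monoid.mulmA /=; congr (op _ _).
rewrite -!Monoid.mulmA /= -(big_ord_recr k (fun s => F (pos s))) big_ord_recl.
rewrite Monoid.mulmCA; congr (op _ (op _ _)).
by apply: eq_bigr => s _; rewrite lift0 posV_slot.
Qed.

Variable N : nat.
Local Notation col T := {ffun T -> 'I_N}.

Definition split_col (c : col (gV P)) :
    col (gV G) * col 'I_k.+1 * col (gV H) :=
  ([ffun a => c (eG a)], [ffun s : 'I_k.+1 => c (pos s)], [ffun b => c (eH b)]).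

Definition glue_col (t : col (gV G) * col 'I_k.+1 * col (gV H)) : col (gV P) :=
  [ffun w => match w with
   | inl (inl a) => t.1.1 a
   | inl (inr s) => t.1.2 (lift ord0 s)
   | inr b => t.2 (val b)
   end].

Lemma split_colK : cancel split_col glue_col.
Proof.
move=> c; apply/ffunP => -[[a|s]|b]; rewrite ffunE /= ffunE //.
  by rewrite lift0 posV_slot.
by rewrite embH_val.
Qed.

(** Gluing drops the colours of position 0 and of [v]; they are recovered exactly when they agree
    with those of [u] and of position [k]. *)
Lemma glue_colK t :
  (split_col (glue_col t) == t) =
  (t.1.2 ord0 == t.1.1 u) && (t.1.2 ord_max == t.2 v).
Proof.
apply/eqP/andP => [<-|[/eqP q0 /eqP qk]].
  by rewrite /= !ffunE embH_root.
have posE (s : 'I_k.+1) : glue_col t (pos s) = t.1.2 s.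
  case: (unliftP ord0 s) => [s'|] ->; last by rewrite ffunE.
  by rewrite lift0 posV_slot ffunE.
case: t => [[cG q] cH] /= in q0 qk posE *.
congr (_, _, _); apply/ffunP => w; rewrite ffunE //; first by rewrite ffunE.
have [->|wv] := eqVneq w v; last first.
  by rewrite -[w](SubK {w | w != v} wv) embH_val ffunE.
by rewrite embH_root (posE ord_max) qk.
Qed.

Lemma proper_split (c : col (gV P)) :
  proper c =
  [&& proper (split_col c).1.1, walk (split_col c).1.2 &
      proper (split_col c).2].
Proof.
apply/forallP/and3P => [pc | [/forallP pG /forallP pq /forallP pH] w].
  split.
  - apply/forallP => a; apply/forallP => b; apply/implyP => ab; rewrite !ffunE.
    apply: (implyP (forallP (pc _) _)); apply/or3P/Or31.
    by apply/existsP; exists a; apply/existsP; exists b; rewrite ab !eqxx.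
  - apply/forallP => s; rewrite !ffunE.
    apply: (implyP (forallP (pc _) _)); apply/or3P/Or33.
    by apply/existsP; exists s; rewrite lift0 !eqxx.
  - apply/forallP => a; apply/forallP => b; apply/implyP => ab; rewrite !ffunE.
    apply: (implyP (forallP (pc _) _)); apply/or3P/Or32.
    by apply/existsP; exists a; apply/existsP; exists b; rewrite ab !eqxx.
apply/forallP => w'; apply/implyP => /or3P[].
- case/existsP=> a /existsP[b /and3P[ab /eqP-> /eqP->]].
  by have := implyP (forallP (pG a) b) ab; rewrite !ffunE.
- case/existsP=> a /existsP[b /and3P[ab /eqP-> /eqP->]].
  by have := implyP (forallP (pH a) b) ab; rewrite !ffunE.
case/existsP=> s; have := pq s; rewrite !ffunE lift0 => cs.
by case/orP=> /andP[/eqP-> /eqP->] //; rewrite eq_sym.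
Qed.

(** [F] may differ from [x] on the copy of [H], so that an indicator weight can later pin a vertex
    of [H] to a colour. *)
Lemma sum_proper_join (R : comNzRingType) (x : 'I_N -> R)
    (F : gV P -> 'I_N -> R) :
  (forall a, a != u -> F (eG a) =1 x) -> (forall s : 'I_k, F (pos s) =1 x) ->
  \sum_(c : col (gV P) | proper c) \prod_w F w (c w) =
  \sum_j \sum_i
     (\sum_(c : col (gV H) | proper c && (c v == j)) \prod_b F (eH b) (c b))
     * ((path_mx x ^+ k) j i * rooted_sum x u i).
Proof.
move=> FG Fpos.
rewrite (reindex_onto glue_col split_col) /=;
  last by move=> c _; rewrite split_colK.
pose B (q : col 'I_k.+1) := \prod_(s < k) x (q (widen_ord (leqnSn k) s)).
pose C (c : col (gV H)) := \prod_b F (eH b) (c b).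
pose A (c : col (gV G)) := \prod_(a | a != u) x (c a).
(* Only triples agreeing at both roots come from a colouring. *)
transitivity (\sum_(t : col (gV G) * col 'I_k.+1 * col (gV H) |
    [&& proper t.1.1, walk t.1.2, proper t.2, t.1.2 ord0 == t.1.1 u
      & t.1.2 ord_max == t.2 v]) A t.1.1 * B t.1.2 * C t.2).
  apply: eq_big => [t|t].
    rewrite proper_split glue_colK.
    have [E|] := boolP ((t.1.2 ord0 == t.1.1 u) && (t.1.2 ord_max == t.2 v));
      last by rewrite !andbF.
    have /eqP-> : split_col (glue_col t) == t by rewrite glue_colK.
    by rewrite !andbT.
  case/andP=> _ /eqP tK; rewrite (big_PV _ (fun w => F w (glue_col t w))).
  congr (_ * _ * _).
  - by apply: eq_bigr => a au; rewrite FG // ffunE.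
  - apply: eq_bigr => s _; rewrite Fpos; congr x.
    by rewrite -[in RHS]tK [RHS]ffunE.
  - apply: eq_bigr => b _; congr (F _ _).
    by rewrite -[in RHS]tK [RHS]ffunE.
(* For a fixed path colouring the sums over [G] and [H] factor. *)
transitivity (\sum_(q : col 'I_k.+1 | walk q) B q * rooted_sum x u (q ord0)
   * \sum_(c : col (gV H) | proper c && (c v == q ord_max)) C c).
  rewrite big_mkcond /= -(pair_bigA _ (fun p c =>
    if [&& proper p.1, walk p.2, proper c, p.2 ord0 == p.1 u
         & p.2 ord_max == c v] then A p.1 * B p.2 * C c else 0)) /=.
  rewrite -(pair_bigA _ (fun a q => \sum_c
    if [&& proper a, walk q, proper c, q ord0 == a u & q ord_max == c v]
    then A a * B q * C c else 0)) /= exchange_big [RHS]big_mkcond.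
  apply: eq_bigr => q _ /=.
  case: (walk q) => /=; last first.
    by rewrite big1 // => a _; rewrite big1 // => c _; rewrite andbF.
  rewrite -mulrA big_distrlr mulr_sumr [RHS]big_mkcond.
  apply: eq_bigr => a _ /=.
  rewrite [a u == _]eq_sym; have [_|_] := boolP (proper a) => /=;
    last by rewrite big1.
  have [_|_] := boolP (_ == a u); last by rewrite big1 // => c _; rewrite andbF.
  rewrite mulr_sumr [RHS]big_mkcond; apply: eq_bigr => c _ /=.
  rewrite [c v == _]eq_sym; case: ifP => // _.
  by rewrite mulrA [B q * _]mulrC.
rewrite (partition_big (fun q : col 'I_k.+1 => q ord_max) xpredT) //=.
apply: eq_bigr => j _.
rewrite (partition_big (fun q : col 'I_k.+1 => q ord0) xpredT) //=.
apply: eq_bigr => i _.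
rewrite -sum_walk [X in _ * X]mulr_suml mulr_sumr; apply: eq_big => [q|q].
  by rewrite -andbA [(_ == j) && _]andbC.
by case/andP=> /andP[_ /eqP->] /eqP->; rewrite mulrC.
Qed.

End PathJoinColoring.

(** * Cliques with two marked vertices *)

Lemma pinned_sum (R : comNzRingType) (N : nat) (x : 'I_N -> R) (T : finType)
    (Q : pred {ffun T -> 'I_N}) (u : T) (j : 'I_N) :
  \sum_(c : {ffun T -> 'I_N} | Q c && (c u == j)) \prod_(w | w != u) x (c w) =
  \sum_(c : {ffun T -> 'I_N} | Q c)
     \prod_w (if w == u then (c w == j)%:R else x (c w)).
Proof.
rewrite [LHS]big_mkcondr; apply: eq_bigr => c _.
rewrite [RHS](bigD1 u) //= eqxx; case: eqP => _; last by rewrite mul0r.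
by rewrite mul1r; apply: eq_bigr => w /negbTE->.
Qed.

(** Injections are grouped by their image: all bijections onto one image share the same weight. *)
Lemma sum_inj_ffun (R : comNzRingType) (N : nat) (x : 'I_N -> R) (T : finType)
    (A : {set 'I_N}) :
  \sum_(q : {ffun T -> 'I_N} | injectiveb q && (q \in ffun_on (mem A)))
     \prod_t x (q t) = #|T|`!%:R * esym_on x A #|T|.
Proof.
rewrite (partition_big (fun q : {ffun T -> 'I_N} => q @: T)
  (fun B : {set 'I_N} => (B \subset A) && (#|B| == #|T|))) /=; last first.
  move=> q /andP[/injectiveP q_inj /ffun_onP qA].
  rewrite card_imset // eqxx andbT; apply/subsetP => k /imsetP[t _ ->].
  exact: qA.
rewrite /esym_on mulr_sumr; apply: eq_bigr => B /andP[sBA /eqP cB].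
transitivity (\sum_(q in 
  [set f : {ffun T -> 'I_N} in ffun_on (mem B) | injectiveb f])
   \prod_(k in B) x k).
  apply: eq_big => [q|q].
    rewrite !inE; case: injectiveP => [q_inj|]; last by rewrite andbF.
    rewrite andbT /=; apply/andP/ffun_onP => [[_ /eqP <-] t|qB].
      exact: imset_f.
    split; first by apply/ffun_onP => t; apply: (subsetP sBA); apply: qB.
    rewrite eqEcard card_imset // cB leqnn andbT.
    by apply/subsetP => k /imsetP[t _ ->]; apply: qB.
  case/andP=> /andP[/injectiveP q_inj _] /eqP <-.
  by rewrite big_imset //= => t t' _ _ /q_inj.
by rewrite sumr_const card_inj_ffuns_on cB ffactnn mulr_natl.
Qed.

(** [a] carries [x i], [b] is the unweighted root, and the other [m - 2] vertices take distinct
    colours different from [i] and [j]. *)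
Lemma sum_proper_clique (R : comNzRingType) (N : nat) (x : 'I_N -> R) (m : nat)
    (a b : 'I_m) (i j : 'I_N) : a != b ->
  \sum_(c : {ffun gV (Kgraph m) -> 'I_N} |
         (proper c && (c a == i)) && (c b == j)) \prod_(w | w != b) x (c w) =
  (m - 2)`!%:R * ((j != i)%:R * x i * esym_on x (setT :\ j :\ i) (m - 2)).
Proof.
move=> ab; pose T : finType := {w : 'I_m | (w != b) && (w != a)}.
(* As [a] is tested first, the default [j] is reached only at [b]. *)
pose ext (q : {ffun T -> 'I_N}) : {ffun 'I_m -> 'I_N} :=
  [ffun w => if w == a then i else if insub w is Some t then q t else j].
have exta q : ext q a = i by rewrite ffunE eqxx.
have extb q : ext q b = j.
  by rewrite ffunE eq_sym (negbTE ab) insubF ?eqxx.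
have extT q (t : T) : ext q (val t) = q t.
  by rewrite ffunE valK; have /andP[_ /negbTE->] := valP t.
pose res (c : {ffun 'I_m -> 'I_N}) : {ffun T -> 'I_N} := [ffun t => c (val t)].
have extK : cancel ext res by move=> q; apply/ffunP => t; rewrite ffunE extT.
have cT : #|T| = (m - 2)%N.
  rewrite card_sig -[m in RHS]card_ord -(cardC (pred2 a b)) card2 ab addKn.
  by apply: eq_card => w; rewrite !inE negb_or andbC.
(* [a] and [b] are adjacent, so equal end colours admit no proper colouring. *)
have [eij|nij] := eqVneq j i.
  rewrite !mul0r mulr0 big_pred0 // => c; apply/negbTE/negP.
  case/andP=> /andP[/forallP/(_ a)/forallP/(_ b)/implyP/(_ ab)].
  by move=> + /eqP ca /eqP cb; rewrite ca cb eij eqxx.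
rewrite (reindex_onto ext res) /=; last first.
  move=> c /andP[/andP[_ /eqP ca] /eqP cb]; apply/ffunP => w.
  have [->|wa] := eqVneq w a; first by rewrite exta ca.
  have [->|wb] := eqVneq w b; first by rewrite extb cb.
  have Tw : (w != b) && (w != a) by rewrite wb.
  by rewrite -[w](SubK T Tw) extT ffunE.
rewrite mul1r mulrCA -cT -sum_inj_ffun mulr_sumr; apply: eq_big => [q|q _].
  rewrite exta extb extK !eqxx !andbT.
  apply/forallP/andP => [pq|[/injectiveP q_inj /ffun_onP qA] w].
    have ext_neq w w' : w != w' -> ext q w != ext q w'.
      by move=> ww'; apply: (implyP (forallP (pq w) w')).
    split.
      apply/injectiveP => t t'; rewrite -!extT => /eqP.
      by apply: contraTeq => tt'; apply: ext_neq.
    apply/ffun_onP => t; rewrite !inE -extT -{1}(exta q) -(extb q).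
    by have /andP[tb ta] := valP t; rewrite !ext_neq.
  apply/forallP => w'; apply/implyP.
  have side (t : T) : q t != i /\ q t != j.
    by have := qA t; rewrite !inE andbT => /andP.
  have cases (v : 'I_m) : [\/ v = a, v = b | exists t : T, v = val t].
    have [->|va] := eqVneq v a; first by constructor 1.
    have [->|vb] := eqVneq v b; first by constructor 2.
    have Tv : (v != b) && (v != a) by rewrite vb.
    by constructor 3; exists (Sub v Tv); rewrite SubK.
  case: (cases w) => [->|->|[t ->]]; case: (cases w') => [->|->|[t' ->]];
    rewrite /= ?exta ?extb ?extT ?eqxx // => ww'.
  - by rewrite eq_sym.
  - by rewrite eq_sym; case: (side t').
  - by rewrite eq_sym; case: (side t').
  - by case: (side t).
  - by case: (side t).
  - by apply: contraNneq ww' => /q_inj ->.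
rewrite (bigD1 a) //= exta; congr (_ * _).
by rewrite big_sig_val; apply: eq_bigr => t _; rewrite extT.
Qed.

Lemma rooted_sum_clique (R : comNzRingType) (N : nat) (x : 'I_N -> R)
    (G : graph) (u : gV G) (m k : nat) (a b : 'I_m) (j : 'I_N) : a != b ->
  rooted_sum x
    (@embH G u (Kgraph m) a k b : gV (Pgraph u (a : gV (Kgraph m)) k)) j =
  (m - 2)`!%:R * \sum_i (j != i)%:R * x i * esym_on x (setT :\ j :\ i) (m - 2)
     * path_act x k (rooted_sum x u) i.
Proof.
(* The colour condition at the root becomes an indicator weight, the form that [sum_proper_join]
   takes. *)
move=> ab; rewrite /rooted_sum pinned_sum.
pose r := @embH G u (Kgraph m) a k b.
have ba : b != a by rewrite eq_sym.
(* Since [b] differs from [a], the root lies outside [G] and the path, where the weight stays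
   [x]. *)
have rE : r = inr (Sub b ba : {w : gV (Kgraph m) | w != a}).
  by rewrite /r -[in LHS](SubK {w : gV (Kgraph m) | w != a} ba) embH_val.
have pos_r s : (@posV G u (Kgraph m) a k s == r) = false.
  by rewrite rE; case: s => //= s; case: insubP.
rewrite (@sum_proper_join _ _ _ _ _ _ _ x
  (fun w i => if w == r then (i == j)%:R else x i)); first last.
- by move=> s i; rewrite pos_r.
- by move=> w _ i; rewrite rE.
rewrite mulr_sumr; apply: eq_bigr => i _.
rewrite -mulr_sumr mulrA -(sum_proper_clique x i j ab) pinned_sum.
congr (_ * _).
apply: eq_bigr => c _; apply: eq_bigr => w _; congr (if _ then _ else _).
have [->|wa] := eqVneq w a; first by rewrite embH_root pos_r (negbTE ab).
rewrite rE -[w in LHS](SubK {w : gV (Kgraph m) | w != a} wa) embH_val.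
by [].
Qed.

(** * Chromatic symmetric functions as path forms *)

Lemma csf_join (N : nat) (G H : graph) (u : gV G) (v : gV H) (k : nat) :
  let x i : {mpoly rat[N]} := 'X_i in
  csf N (Pgraph u v k) = path_form x k (rooted_sum x v) (rooted_sum x u).
Proof.
move=> x.
have E := @sum_proper_join G u H v k N _ x (fun _ => x)
  (fun _ _ _ => erefl) (fun _ _ => erefl).
apply: (etrans E).
apply: eq_bigr => j _; apply: eq_bigr => i _; congr (_ * _).
rewrite mulr_sumr; apply: eq_bigr => c /andP[_ /eqP cv].
by rewrite (bigD1 v) //= cv.
Qed.

Lemma rooted_sum_K1 (R : comNzRingType) (N : nat) (x : 'I_N -> R) j :
  rooted_sum x (tt : gV K1) j = 1.
Proof.
rewrite /rooted_sum (big_pred1 [ffun => j]) => [|c].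
  by rewrite big_pred0 // => -[].
apply/andP/eqP => [[_ /eqP ctt]|->]; last first.
  by split; [apply/forallP => a; apply/forallP | rewrite ffunE].
by apply/ffunP => -[]; rewrite ffunE.
Qed.

(** The path is cut so that the [l] edges next to [G] are absorbed in [path_act], as they are in the
    clique formula. *)
Lemma csf_pend (N : nat) (G : graph) (u : gV G) (k l : nat) :
  let x i : {mpoly rat[N]} := 'X_i in
  csf N (Gpend u (k + l)) =
  \sum_i x i * walk_col x k i 0 * path_act x l (rooted_sum x u) i.
Proof.
move=> x; rewrite /Gpend csf_join -/x -path_form_actr -path_form1.
apply: eq_bigr => j _; apply: eq_bigr => i _.
by rewrite rooted_sum_K1.
Qed.

Lemma elemE (N n : nat) :
  elem N n = esym_on (fun i => 'X_i : {mpoly rat[N]}) setT n.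
Proof. by apply: eq_bigl => B; rewrite subsetT. Qed.

Unset Implicit Arguments.

Theorem theorem5p1 (G H : graph) (vG : gV G) (vH : gV H) (g h m : nat)
  (x y : 'I_m) :
  simple G -> simple H -> (2 <= m)%N -> x != y ->
  forall N : nat,
  ((m - 2)`!%:R : rat)^-1 *: csf N (KmGH vG vH g h x y)
  = \sum_(1 <= z < m) (z%:R : rat) *:
        (elem N (m - 1 - z) * csf N (Pgraph vG vH (g + h + z)))
    + ((m - 2)%N%:R : rat) *:
      \sum_(a < m - 1) \sum_(b < m - 1) \sum_(c < m - 1 | (a + b + c == m - 2)%N)
        ((a%:R - 1 : rat) *:
           (elem N a * csf N (Gpend vG (b + g)) * csf N (Gpend vH (c + h)))).
Proof.
move=> _ _ m_ge2 xy N.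
pose X i : {mpoly rat[N]} := 'X_i.
pose phi := path_act X g (rooted_sum X vG).
pose psi := path_act X h (rooted_sum X vH).
have -> : csf N (KmGH vG vH g h x y) =
    (m - 2)`!%:R * \sum_j \sum_i X j * psi j *
      ((j != i)%:R * X i * esym_on X (setT :\ j :\ i) (m - 2) * phi i).
  (* [h] is read as [0 + h]: its path moves into [psi], and [H] so lengthened is identified with the
     clique at [y]. *)
  rewrite /KmGH csf_join -/X -[h]add0n -path_form_actl -/psi path_form0.
  rewrite mulr_sumr.
  apply: eq_bigr => j _; rewrite rooted_sum_clique // mulrCA -/phi.
  by congr (_ * _); rewrite [LHS]mulr_sumr.
have scale_nat (k : nat) (p : {mpoly rat[N]}) : k%:R * p = (k%:R : rat) *: p.
  by rewrite scaler_nat mulr_natl.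
rewrite scale_nat scalerA mulVf ?scale1r; last first.
  by rewrite Num.Theory.pnatr_eq0 -lt0n fact_gt0.
(* Bounds are brought to the form of [esym_pair_form] at [n = m - 2]; this uses [2 <= m]. *)
have -> : (m - 1 = (m - 2).+1)%N by lia.
have -> : \sum_(1 <= z < m) (z%:R : rat) *:
      (elem N ((m - 2).+1 - z) * csf N (Pgraph vG vH (g + h + z))) =
    \sum_(1 <= z < (m - 2).+2) z%:R * (esym_on X setT ((m - 2).+1 - z)
      * path_form X z psi phi).
  have -> : (m - 2).+2 = m by lia.
  apply: eq_bigr => z _; rewrite scale_nat elemE csf_join.
  (* [psi] and [phi] give their lengths [h] and [g] back to the path. *)
  rewrite path_form_actl path_form_actr.
  by have -> : (z + h + g = g + h + z)%N by lia.
rewrite esym_pair_form scale_nat; congr (_ + _ *: _).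
apply: eq_bigr => a _; apply: eq_bigr => b _; apply: eq_bigr => c _.
by rewrite elemE !csf_pend scalerBl scale1r -scale_nat mulrBl mul1r.
Qed.
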